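(* Let $\mathbb{T}$ be a time scale and let $f:\mathbb{T}\to\mathbb{R}$. If $f$ is delta and nabla differentiable, then $f$ is symmetric differentiable and, for each $t\in\mathbb{T}_{\kappa}^{\kappa}$, $$f^{\diamondsuit}(t)=\gamma(t)\,f^{\Delta}(t)+(1-\gamma(t))\,f^{\nabla}(t),$$ where $$\gamma(t)=\lim_{s\to t}\frac{\sigma(t)-s}{\sigma(t)+2t-2s-\rho(t)}.$$
   Context: A time scale $\mathbb{T}$ is a nonempty closed subset of $\mathbb{R}$, with the topology inherited from the standard topology of $\mathbb{R}$. The forward jump operator $\sigma:\mathbb{T}\to\mathbb{T}$ is $\sigma(t):=\inf\{s\in\mathbb{T}:s>t\}$ with the convention $\inf\emptyset=\sup\mathbb{T}$ (so $\sigma(M)=M$ if $\mathbb{T}$ has a maximum $M$); the backward jump operator $\rho:\mathbb{T}\to\mathbb{T}$ is $\rho(t):=\sup\{s\in\mathbb{T}:s<t\}$ with $\sup\emptyset=\inf\mathbb{T}$ (so $\rho(m)=m$ if $\mathbb{T}$ has a minimum $m$). A point $t\in\mathbb{T}$ is right-scattered if $\sigma(t)>t$ and left-scattered if $\rho(t)<t$. If $\sup\mathbb{T}$ is finite and left-scattered, $\mathbb{T}^{\kappa}:=\mathbb{T}\setminus\{\sup\mathbb{T}\}$, otherwise $\mathbb{T}^{\kappa}:=\mathbb{T}$; if $\inf\mathbb{T}$ is finite and right-scattered, $\mathbb{T}_{\kappa}:=\mathbb{T}\setminus\{\inf\mathbb{T}\}$, otherwise $\mathbb{T}_{\kappa}:=\mathbb{T}$;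 $\mathbb{T}_{\kappa}^{\kappa}:=\mathbb{T}_{\kappa}\cap\mathbb{T}^{\kappa}$. Write $f^{\sigma}:=f\circ\sigma$ and $f^{\rho}:=f\circ\rho$. Symmetric derivative: for $f:\mathbb{T}\to\mathbb{R}$ and $t\in\mathbb{T}_{\kappa}^{\kappa}$, the symmetric derivative of $f$ at $t$, denoted $f^{\diamondsuit}(t)$, is the real number (provided it exists) such that for every $\varepsilon>0$ there is a neighborhood $U\subset\mathbb{T}$ of $t$ with $$\left|\left[f^{\sigma}(t)-f(s)+f(2t-s)-f^{\rho}(t)\right]-f^{\diamondsuit}(t)\left[\sigma(t)+2t-2s-\rho(t)\right]\right|\leqslant\varepsilon\left|\sigma(t)+2t-2s-\rho(t)\right|$$ for all $s\in U$ for which $2t-s\in U$. The function $f$ is symmetric differentiable if $f^{\diamondsuit}(t)$ exists for all $t\in\mathbb{T}_{\kappa}^{\kappa}$. Delta and nabla derivatives (standard in time scale calculus): $f$ is delta differentiable if for every $t\in\mathbb{T}^{\kappa}$ there is a real number $f^{\Delta}(t)$ such that for every $\varepsilon>0$ there is a neighborhood $U\subset\mathbb{T}$ of $t$ with $|f^{\sigma}(t)-f(s)-f^{\Delta}(t)(\sigma(t)-s)|\leqslant\varepsilon|\sigma(t)-s|$ for all $s\in U$; $f$ is nabla differentiable if for every $t\in\mathbb{T}_{\kappa}$ there is a real number $f^{\nabla}(t)$ such that for every $\varepsilon>0$ there is a neighborhood $U\subset\mathbb{T}$ of $t$ with $|f^{\rho}(t)-f(s)-f^{\nabla}(t)(\rho(t)-s)|\leqslant\varepsilon|\rho(t)-s|$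 for all $s\in U$. In the limit defining $\gamma(t)$, $s$ ranges over the points of $\mathbb{T}$ at which the quotient is defined; $s=t$ is allowed when $\sigma(t)\neq\rho(t)$ (so at an isolated point $t$ the limit is the value of the quotient at $s=t$). *)

(* Defs.v *)
From mathcomp Require Import all_boot all_order all_algebra.
From mathcomp Require Import all_classical all_reals all_analysis.
Set Implicit Arguments.
Unset Strict Implicit.
Unset Printing Implicit Defensive.
Import Order.TTheory GRing.Theory Num.Theory.
Import numFieldNormedType.Exports.
Local Open Scope classical_set_scope.
Local Open Scope ring_scope.

(* A function on the time scale T is represented by f : R -> R; the notions
   below evaluate f only at points of T (the jump operators map T to T). *)

Definition time_scale (R : realType) (T : set R) : Prop := T !=set0 /\ closed T.

(* The library's inf and sup of the empty set are 0, hence the explicit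
   conventions inf set0 = sup T and sup set0 = inf T. They are used only when
   t is a maximum (resp. minimum) of T, so sup T (resp. inf T) is then t. *)
Definition sigma (R : realType) (T : set R) (t : R) : R :=
  if `[< [set s | T s /\ t < s] !=set0 >]
  then inf [set s | T s /\ t < s] else sup T.

Definition rho (R : realType) (T : set R) (t : R) : R :=
  if `[< [set s | T s /\ s < t] !=set0 >]
  then sup [set s | T s /\ s < t] else inf T.

Definition right_scattered (R : realType) (T : set R) (t : R) : Prop :=
  t < sigma T t.

Definition left_scattered (R : realType) (T : set R) (t : R) : Prop :=
  rho T t < t.

(* kappa_up is T^kappa (superscript), kappa_down is T_kappa (subscript). *)
Definition kappa_up (R : realType) (T : set R) : set R :=
  if `[< has_ubound T /\ left_scattered T (sup T) >]
  then T `\ sup T else T.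

Definition kappa_down (R : realType) (T : set R) : set R :=
  if `[< has_lbound T /\ right_scattered T (inf T) >]
  then T `\ inf T else T.

Definition kappa_both (R : realType) (T : set R) : set R :=
  kappa_down T `&` kappa_up T.

(* within T (nbhs t) U alone does not force U to be a subset of T. *)
Definition ts_nbhs (R : realType) (T : set R) (t : R) (U : set R) : Prop :=
  U `<=` T /\ within T (nbhs t) U.

Definition is_delta_derivative (R : realType) (T : set R) (f : R -> R)
    (t d : R) : Prop :=
  forall e : R, 0 < e -> exists2 U : set R, ts_nbhs T t U &
    forall s, U s ->
      `|f (sigma T t) - f s - d * (sigma T t - s)| <= e * `|sigma T t - s|.

Definition delta_differentiable (R : realType) (T : set R) (f : R -> R) : Prop :=
  forall t, kappa_up T t -> exists d, is_delta_derivative T f t d.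

Definition is_nabla_derivative (R : realType) (T : set R) (f : R -> R)
    (t d : R) : Prop :=
  forall e : R, 0 < e -> exists2 U : set R, ts_nbhs T t U &
    forall s, U s ->
      `|f (rho T t) - f s - d * (rho T t - s)| <= e * `|rho T t - s|.

Definition nabla_differentiable (R : realType) (T : set R) (f : R -> R) : Prop :=
  forall t, kappa_down T t -> exists d, is_nabla_derivative T f t d.

Definition sym_increment (R : realType) (T : set R) (t s : R) : R :=
  sigma T t + 2 * t - 2 * s - rho T t.

(* This is a relation because d need not be unique: if sigma T t = rho T t
   and s = t is the only s near t with s and 2 * t - s both in T (e.g. t is a
   left-dense maximum of T), then every d satisfies the condition. *)
Definition is_symmetric_derivative (R : realType) (T : set R) (f : R -> R)
    (t d : R) : Prop :=
  forall e : R, 0 < e -> exists2 U : set R, ts_nbhs T t U &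
    forall s, U s -> U (2 * t - s) ->
      `|(f (sigma T t) - f s + f (2 * t - s) - f (rho T t))
        - d * sym_increment T t s| <= e * `|sym_increment T t s|.

Definition symmetric_differentiable (R : realType) (T : set R) (f : R -> R) : Prop :=
  forall t, kappa_both T t -> exists d, is_symmetric_derivative T f t d.

(* The limit is over the points of T where the quotient is defined; s = t is
   among them exactly when sigma T t != rho T t. *)
Definition is_gamma (R : realType) (T : set R) (t g : R) : Prop :=
  (sigma T t - s) / sym_increment T t s
    @[s --> within [set s | T s /\ sym_increment T t s != 0] (nbhs t)] --> g.

(* Main.v *)
Require Import Defs.
From mathcomp Require Import all_boot all_order all_algebra.
From mathcomp Require Import all_classical all_reals all_analysis.
From mathcomp Require Import ring lra.
Import Order.TTheory GRing.Theory Num.Theory.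
Import numFieldNormedType.Exports.
Local Open Scope classical_set_scope.
Local Open Scope ring_scope.

(** Write [D s] for the symmetric increment [sigma t + 2 t - 2 s - rho t] and
    [q s := (sigma t - s) / D s] for the quotient whose limit is [gamma t].
    Since [D s = (sigma t - s) + ((2 t - s) - rho t)], adding the delta
    estimate at [s] to the nabla estimate at [2 t - s] shows that, up to
    [e * (`|q s| + `|1 - q s|) * `|D s|], the numerator of the symmetric
    difference quotient is [D s * (q s * fdelta + (1 - q s) * fnabla)].  Near
    [t] the ratio [q s] is close to [gamma t], hence bounded, which gives the
    formula ([symmetric_derivative_of_gamma]).

    The argument divides by [D s].  As [rho t <= t <= sigma t], the increment
    vanishes near [t] only at [s = t], and only when [sigma t = rho t = t]
    ([near_sym_increment_eq0]); there the numerator vanishes as well.  The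
    same dichotomy gives the existence of [gamma t] ([is_gamma_exists]): if
    [sigma t <> rho t] the quotient is continuous at [t], and otherwise it is
    constantly [1 / 2]. *)

Section SymmetricDerivative.
Set Implicit Arguments.
Unset Strict Implicit.
Context {R : realType}.
Implicit Types (T U : set R) (f : R -> R) (t s : R).

Lemma kappa_up_sub T : kappa_up T `<=` T.
Proof. by move=> t; rewrite /kappa_up; case: asboolP => // _ []. Qed.

Lemma kappa_down_sub T : kappa_down T `<=` T.
Proof. by move=> t; rewrite /kappa_down; case: asboolP => // _ []. Qed.

Lemma sigma_ge T t : T t -> t <= sigma T t.
Proof.
move=> Tt; rewrite /sigma; case: asboolP => [ne|noright].
  by apply: lb_le_inf => // s [_ /ltW].
apply: ub_le_sup => //; exists t => s Ts; rewrite leNgt.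
by apply/negP => ts; apply: noright; exists s.
Qed.

Lemma rho_le T t : T t -> rho T t <= t.
Proof.
move=> Tt; rewrite /rho; case: asboolP => [ne|noleft].
  by apply: ge_sup => // s [_ /ltW].
apply: ge_inf => //; exists t => s Ts; rewrite leNgt.
by apply/negP => st; apply: noleft; exists s.
Qed.

Lemma near_sym_increment_eq0 T t : T t ->
  \forall s \near t, sym_increment T t s = 0 ->
    [/\ s = t, sigma T t = t & rho T t = t].
Proof.
move=> Tt; have sg := sigma_ge Tt; have rh := rho_le Tt.
have [E|E] := eqVneq (sigma T t) (rho T t).
  by near=> s; rewrite /sym_increment => D0; split; lra.
have gap : 0 < (sigma T t - rho T t) / 2.
  by rewrite divr_gt0// subr_gt0 lt_def E (le_trans rh).
near=> s; rewrite /sym_increment => D0; exfalso.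
have : s < t + (sigma T t - rho T t) / 2.
  by near: s; apply: lt_nbhsl; rewrite ltrDl.
lra.
Unshelve. all: by end_near. Qed.

(** When [sigma T t = rho T t] the quotient equals [1 / 2] wherever it is
    defined; if moreover [t] is isolated in [T], it is defined nowhere near [t]
    and the limit holds vacuously. *)
Lemma is_gamma_exists T t : T t -> exists g, is_gamma T t g.
Proof.
move=> Tt; have sg := sigma_ge Tt; have rh := rho_le Tt.
have [E|E] := eqVneq (sigma T t) (rho T t).
  exists (1 / 2); rewrite /is_gamma; apply: cvg_near_cst.
  near=> s; have [_] : T s /\ sym_increment T t s != 0 by near: s; exact: withinT.
  rewrite /sym_increment => D0.
  have -> : sigma T t - s = 1 / 2 * (sigma T t + 2 * t - 2 * s - rho T t) by lra.
  by rewrite mulfK.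
exists ((sigma T t - t) / sym_increment T t t).
apply: cvg_within_filter; apply: cvgM.
  by apply: cvgB; [exact: cvg_cst|exact: cvg_id].
apply: cvgV.
  by rewrite /sym_increment; apply: contra_neq E => D0; lra.
rewrite /sym_increment; apply: cvgB; last exact: cvg_cst.
apply: cvgB; first exact: cvg_cst.
by apply: cvgM; [exact: cvg_cst|exact: cvg_id].
Unshelve. all: by end_near. Qed.

Lemma ts_nbhsI T t U1 U2 :
  ts_nbhs T t U1 -> ts_nbhs T t U2 -> ts_nbhs T t (U1 `&` U2).
Proof. by move=> [U1T ?] [_ ?]; split; [move=> s [/U1T]|exact: filterI]. Qed.

Lemma ts_nbhs_near T t U : nbhs t U -> ts_nbhs T t (T `&` U).
Proof.
move=> tU; split; first by move=> s [].
by rewrite /within /=; near=> s => Ts; split=> //; near: s.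
Unshelve. all: by end_near. Qed.

(** This is a pointwise statement: only the derivatives at [t] are used. *)
Lemma symmetric_derivative_of_gamma T f t g fdelta fnabla : T t ->
  is_gamma T t g ->
  is_delta_derivative T f t fdelta ->
  is_nabla_derivative T f t fnabla ->
  is_symmetric_derivative T f t (g * fdelta + (1 - g) * fnabla).
Proof.
move=> Tt gammag deltaf nablaf e e0.
(* [c] bounds `|q s| + `|1 - q s| + `|fdelta - fnabla| once `|g - q s| <= 1. *)
pose c := 2 * `|g| + 3 + `|fdelta - fnabla|.
have c0 : 0 < c by rewrite /c; have := normr_ge0 g;
  have := normr_ge0 (fdelta - fnabla); lra.
pose n := Num.min 1 (e / c).
have n0 : 0 < n by rewrite lt_min ltr01 divr_gt0.
have n1 : n <= 1 by rewrite ge_min lexx.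
have nc : n * c <= e by rewrite -ler_pdivlMr// ge_min lexx orbT.
have [U1 tU1 HU1] := deltaf n n0.
have [U2 tU2 HU2] := nablaf n n0.
have tU3 := ts_nbhs_near T (near_sym_increment_eq0 Tt).
move: gammag; rewrite /is_gamma => /cvgrPdist_le/(_ _ n0)/(@ts_nbhs_near T) tU4.
set U3 := (X in ts_nbhs _ _ X) in tU3.
set U4 := (X in ts_nbhs _ _ X) in tU4.
exists (U1 `&` U2 `&` (U3 `&` U4)).
  by apply: ts_nbhsI (ts_nbhsI tU1 tU2) (ts_nbhsI tU3 tU4).
move=> s [[U1s _] [[Ts U3s] [_ U4s]]] [[_ U2s'] _].
have [D0|D0] := eqVneq (sym_increment T t s) 0.
  (* The only degenerate point is [s = t], where both sides are zero. *)
  have [st sgt rht] := U3s D0; rewrite D0 sgt rht st.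
  have -> : 2 * t - t = t by ring.
  have -> : f t - f t + f t - f t = 0 by ring.
  by rewrite !mulr0 subr0 normr0 mulr0.
have /= qg := U4s (conj Ts D0).
have ds := HU1 _ U1s; have ns := HU2 _ U2s'.
set D := sym_increment T t s in D0 qg *.
set q := (sigma T t - s) / D in qg.
have qD : sigma T t - s = q * D by rewrite /q divfK.
have q'D : rho T t - (2 * t - s) = - ((1 - q) * D).
  by rewrite mulrBl mul1r -qD /D /sym_increment; ring.
rewrite qD normrM in ds; rewrite q'D normrN normrM in ns.
set a := (X in `|X| <= _) in ds; set b := (X in `|X| <= _) in ns.
have -> : f (sigma T t) - f s + f (2 * t - s) - f (rho T t)
    - (g * fdelta + (1 - g) * fnabla) * D
    = a - b - (g - q) * (fdelta - fnabla) * D by rewrite /a /b; ring.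
have q_le : `|q| <= `|g| + 1.
  have -> : q = g - (g - q) by ring.
  by rewrite (le_trans (ler_normB _ _))// lerD2l (le_trans qg).
have q'_le : `|1 - q| <= `|g| + 2.
  by rewrite (le_trans (ler_normB _ _))// normr1; lra.
apply: le_trans (_ : n * c * `|D| <= _); last by rewrite ler_wpM2r.
apply: le_trans (ler_normB _ _) _; rewrite !normrM.
apply: le_trans (lerD (ler_normB _ _) (lexx _)) _.
apply: le_trans (lerD (lerD ds ns) (lexx _)) _.
rewrite !mulrA -!mulrDl ler_wpM2r// -mulrDr.
apply: le_trans (lerD (lexx _) (ler_wpM2r (normr_ge0 _) qg)) _.
by rewrite -mulrDr ler_pM2l// /c; lra.
Qed.

End SymmetricDerivative.

Theorem proposition4p2 (R : realType) (T : set R) (f : R -> R)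
    (hT : time_scale T)
    (hdelta : delta_differentiable T f) (hnabla : nabla_differentiable T f) :
  symmetric_differentiable T f /\
  forall t : R, kappa_both T t ->
    (exists g : R, is_gamma T t g) /\
    (forall g fdelta fnabla : R,
       is_gamma T t g ->
       is_delta_derivative T f t fdelta ->
       is_nabla_derivative T f t fnabla ->
       is_symmetric_derivative T f t (g * fdelta + (1 - g) * fnabla)).
Proof.
split=> [t [tdown tup]|t [_ /kappa_up_sub Tt]]; last first.
  by split=> [|g fd fn]; [exact: is_gamma_exists|
    exact: symmetric_derivative_of_gamma].
have Tt := kappa_up_sub tup.
have [g gammag] := is_gamma_exists Tt.
have [fd dfd] := hdelta t tup; have [fn nfn] := hnabla t tdown.
by exists (g * fd + (1 - g) * fn); exact: symmetric_derivative_of_gamma.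
Qed.
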